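(* For any doubly even self-dual code $C$, $(\tilde{\mathcal{D}}(C)\ast\tilde{\mathcal{D}}(C))^\perp=\tilde{\mathcal{D}}(C)$. In particular, $\tilde{\mathcal{D}}(C)$ is a maximal triply even code.
   Context: A code of length $n$ is a linear subspace of $\mathbb{F}_2^n$. $\operatorname{supp}(u)$ is the set of coordinates where $u$ is $1$ and $\operatorname{wt}(u)=|\operatorname{supp}(u)|$. A code is doubly even (resp. triply even) if every codeword has weight divisible by $4$ (resp. $8$). A triply even code is maximal if it is not contained in any larger triply even code of the same length. $C^\perp$ is the dual with respect to the standard inner product; $C$ is self-dual if $C=C^\perp$. $u\ast v$ is the vector with support $\operatorname{supp}(u)\cap\operatorname{supp}(v)$, and for $C,D\subset\mathbb{F}_2^n$, $C\ast D=\langle u\ast v\mid u\in C, v\in D\rangle$ (linear span). $(u|v)$ denotes concatenation and $\mathbf 0_n$ is the zero vector. For a doubly even code $C$ of length $n$ define $B:C\times C^\perp\to\mathbb{F}_2$, $B(v,u)=\frac{\operatorname{wt}(v\ast u)}{2}\bmod 2$; $\operatorname{rad}C=\{y\in C^\perp\mid B(x,y)=0\ \text{for all } x\in C\}$; $\operatorname{Rad}C=\{x\in\operatorname{rad}C\mid \operatorname{wt}(x)\equiv0\pmod 8\}$. The generalized doubling of $C$ is the code of length $2n$ $$\tilde{\mathcal{D}}(C)=\langle \{(r|\mathbf 0_n)\mid r\in C\cap\operatorname{Rad}C\}\cup\{(x|x)\mid x\in C\}\rangle.$$ *)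

(* Defs.v *)
From HB Require Import structures.
From mathcomp Require Import all_boot all_order all_algebra.

Set Implicit Arguments.
Unset Strict Implicit.
Unset Printing Implicit Defensive.

Import GRing.Theory.
Local Open Scope ring_scope.

Notation word n := 'rV['F_2]_n (only parsing).
Notation code n := {vspace 'rV['F_2]_n} (only parsing).

Section Codes.
Variable n : nat.
Implicit Types (u v w : word n) (C D : code n).

Definition supp u : {set 'I_n} := [set i | u 0 i == 1].
Definition wt u : nat := #|supp u|.

Definition doubly_even C : Prop := forall u, u \in C -> (4 %| wt u)%N.
Definition triply_even C : Prop := forall u, u \in C -> (8 %| wt u)%N.

Definition maximal_triply_even C : Prop :=
  triply_even C /\
  forall D, triply_even D -> (C <= D)%VS -> D = C.

Definition inner u v : 'F_2 := \sum_(i < n) u 0 i * v 0 i.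

(* The spanning list is already closed under linear combinations; see
   [mem_dual]. *)
Definition dual C : code n :=
  span [seq u <- enum 'rV['F_2]_n | [forall v in C, inner u v == 0]].

Definition self_dual C : Prop := C = dual C.

(* Over 'F_2 the coordinatewise product is the word supported on the
   intersection of the supports; see [supp_wstar]. *)
Definition wstar u v : word n := \row_i (u 0 i * v 0 i).

Definition cstar C D : code n :=
  span [seq wstar u v | u <- enum C, v <- enum D].

(* Meaningful for v in C and u in dual C: then wt (wstar v u) is even, so
   the halving is exact. *)
Definition Bform v u : 'F_2 := ((wt (wstar v u))./2)%:R.

Definition rad C : {set word n} :=
  [set y in dual C | [forall x in C, Bform x y == 0]].

Definition Rad C : {set word n} := [set x in rad C | (8 %| wt x)%N].

Definition gdoubling C : code (n + n) :=
  span ([seq row_mx r (0 : word n) | r <- enum [set x in C | x \in Rad C]]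
        ++ [seq row_mx x x | x <- enum C]).

Lemma mem_dual C u :
  reflect (forall v, v \in C -> inner u v = 0) (u \in dual C).
Proof.
apply: (iffP idP) => [|h]; last first.
  apply: memv_span; rewrite mem_filter mem_enum andbT.
  by apply/forall_inP => v /h ->.
rewrite /dual; set X := [seq w <- _ | _] => uX v vC.
rewrite (coord_span (uX : u \in span (in_tuple X))) /inner.
under eq_bigr => i _ do rewrite summxE mulr_suml.
rewrite exchange_big big1 // => k _.
under eq_bigr => i _ do rewrite mxE -mulrA.
rewrite -mulr_sumr.
have: (in_tuple X)`_k \in X by apply: mem_nth.
rewrite mem_filter => /andP[/forall_inP/(_ v vC)/eqP + _].
by rewrite /inner => ->; rewrite mulr0.
Qed.

Lemma supp_wstar u v : supp (wstar u v) = supp u :&: supp v.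
Proof.
apply/setP => i; rewrite !inE mxE.
by case: (u 0 i) => [[|[|?]] ?] //; case: (v 0 i) => [[|[|?]] ?].
Qed.

Lemma inner_wt u v : inner u v = (wt (wstar u v))%:R.
Proof.
rewrite /inner /wt -sum1_card natr_sum [RHS]big_mkcond /=.
apply: eq_bigr => i _; rewrite inE mxE.
by case: (u 0 i * v 0 i) => [[|[|?]] ?] //; apply/val_inj.
Qed.

End Codes.

(* Main.v *)
Require Import Defs.
From mathcomp Require Import all_boot all_order all_algebra.
From mathcomp Require Import algC.

Set Implicit Arguments.
Unset Strict Implicit.
Unset Printing Implicit Defensive.

Import GRing.Theory Num.Theory.
Local Open Scope ring_scope.

(** The proof rests on replacing [Rad C] by the dual of [C * C].  For [C]
    doubly even and self-dual, a word [r] is orthogonal to [C * C] exactly when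
    [r * C] is contained in [C] ([multiplierP]); call such a word a multiplier.
    Multipliers have weight divisible by 8 ([multiplier_wt8]), and it follows
    that [Rad C] is the set of multipliers ([mem_Rad]).  The weight statement
    is the arithmetic heart of the matter.  It is proved by evaluating the sum
    of [i ^ wt x] over the words [x] supported in [supp y] in two ways: as
    [(1 + i) ^ wt y], coordinate by coordinate, and as the number of codewords
    of [C] supported in [supp y], by averaging over translates and using
    self-duality.

    The elements of the doubling are then the words [(r + x | x)] with [r] a
    multiplier and [x] in [C].  Such a word has weight
    [wt r + 2 wt x - 2 wt (r * x)], where [8 | wt r], and [4] divides both
    [wt x] and [wt (r * x)] because [x] and [r * x] are codewords; so the
    doubling [D] is triply even.  In a triply even code any three words meet in
    an even number of positions, which gives the inclusion of [D] in the dual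
    of [D * D], and places every triply even code containing [D] in that dual.
    Conversely let [(a | b)] be orthogonal to [D * D].  Testing against
    [(x | x) * (y | y)] shows that [a + b] is a multiplier.  The all-one word
    is a multiplier, so [(1 | 0)] is in [D], and testing against
    [(1 | 0) * (x | x) = (x | 0)] shows that [a] is in [C].  Therefore
    [(a | b) = (a + b | 0) + (b | b)] is in [D], and both claims follow. *)

(** * Words and codes over the field with two elements *)

Lemma F2P (a : 'F_2) : a = 0 \/ a = 1.
Proof. by case: a => [[|[|?]] ?] //; [left|right]; apply/val_inj. Qed.

Lemma natF2_eq0 m : ((m%:R : 'F_2) == 0) = (2 %| m)%N.
Proof. by rewrite (dvdn_pcharf (pchar_Fp (isT : prime 2))). Qed.

(** The only nonzero scalar is 1, so closure under addition suffices. *)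
Lemma F2_span_ind (V : vectType 'F_2) (P : V -> Prop) (X : seq V) :
    P 0 -> (forall u v, P u -> P v -> P (u + v)) ->
    (forall u, u \in X -> P u) ->
  forall u, u \in <<X>>%VS -> P u.
Proof.
move=> P0 PD PX u uX; rewrite (coord_span (uX : u \in span (in_tuple X))).
apply: (big_ind P) => // k _.
case: (F2P (coord (in_tuple X) k u)) => ->; first by rewrite scale0r.
by rewrite scale1r; apply/PX/mem_nth.
Qed.

Section Words.
Variable n : nat.
Implicit Types (u v w x y : 'rV['F_2]_n) (C D : {vspace 'rV['F_2]_n}).

Lemma word_addvv u : u + u = 0.
Proof.
by apply/rowP => i; rewrite !mxE; case: (F2P (u 0 i)) => ->; apply/val_inj.
Qed.

Lemma wstarC u v : wstar u v = wstar v u.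
Proof. by apply/rowP => i; rewrite !mxE mulrC. Qed.

Lemma wstarA u v w : wstar u (wstar v w) = wstar (wstar u v) w.
Proof. by apply/rowP => i; rewrite !mxE mulrA. Qed.

Lemma wstarDl u v w : wstar (u + v) w = wstar u w + wstar v w.
Proof. by apply/rowP => i; rewrite !mxE mulrDl. Qed.

Lemma wstarvv u : wstar u u = u.
Proof.
by apply/rowP => i; rewrite !mxE; case: (F2P (u 0 i)) => ->; apply/val_inj.
Qed.

Lemma wstar1 u : wstar u (const_mx 1) = u.
Proof. by apply/rowP => i; rewrite !mxE mulr1. Qed.

Lemma wstar0 u : wstar 0 u = 0.
Proof. by apply/rowP => i; rewrite !mxE mul0r. Qed.

Lemma wtE u : wt u = (\sum_(i < n) (u 0 i == 1)%R)%N.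
Proof.
rewrite /wt -sum1_card [LHS]big_mkcond; apply: eq_bigr => i _.
by rewrite inE; case: eqP.
Qed.

Lemma wtD u v : (wt (u + v) + 2 * wt (wstar u v) = wt u + wt v)%N.
Proof.
rewrite !wtE big_distrr -!big_split; apply: eq_bigr => i _; rewrite !mxE.
by case: (F2P (u 0 i)) => ->; case: (F2P (v 0 i)) => ->.
Qed.

Lemma inner_eq0 u v : (inner u v == 0) = (2 %| wt (wstar u v))%N.
Proof. by rewrite inner_wt natF2_eq0. Qed.

Lemma innerC u v : inner u v = inner v u.
Proof. by rewrite !inner_wt wstarC. Qed.

Lemma innerA u v w : inner (wstar u v) w = inner u (wstar v w).
Proof. by rewrite !inner_wt wstarA. Qed.

Lemma innerDl u v w : inner (u + v) w = inner u w + inner v w.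
Proof.
by rewrite /inner -big_split; apply: eq_bigr => i _; rewrite mxE mulrDl.
Qed.

Lemma innerDr u v w : inner u (v + w) = inner u v + inner u w.
Proof. by rewrite innerC innerDl !(innerC u). Qed.

Lemma inner0r u : inner u 0 = 0.
Proof. by rewrite /inner big1 // => i _; rewrite mxE mulr0. Qed.

Lemma mem_dual_cstar C D u :
  reflect (forall v w, v \in C -> w \in D -> inner u (wstar v w) = 0)
          (u \in dual (cstar C D)).
Proof.
apply: (iffP (mem_dual _ _)) => [h v w vC wD | h v].
  apply: h; apply: memv_span.
  by apply: (allpairs_f (@wstar n)); rewrite mem_enum.
move: v; apply: (F2_span_ind (P := fun v => inner u v = 0)).
- exact: inner0r.
- by move=> v1 v2 h1 h2; rewrite innerDr h1 h2 addr0.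
by move=> _ /allpairsP[[v1 v2] /= [h1 h2 ->]]; apply: h; rewrite -mem_enum.
Qed.

(** Inclusion-exclusion applied to [u * r] and [v * r], whose common part is
    [u * v * r]: the overlap enters twice, so divisibility by 4 of the three
    weights forces it to be even. *)
Lemma inner_wstar_eq0 r u v :
    (4 %| wt (wstar u r))%N -> (4 %| wt (wstar v r))%N ->
    (4 %| wt (wstar (u + v) r))%N ->
  inner r (wstar u v) = 0.
Proof.
move=> u4 v4 uv4; apply/eqP; rewrite inner_eq0.
have := dvdn_add u4 v4.
rewrite -wtD -wstarDl dvdn_addr // (@dvdn_pmul2l 2 2) //.
suff -> : wstar (wstar u r) (wstar v r) = wstar r (wstar u v) by [].
by rewrite -wstarA (wstarC v r) (wstarA r) wstarvv wstarA (wstarC u) -wstarA.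
Qed.

Lemma dvdn4_wt_wstar C u v :
  triply_even C -> u \in C -> v \in C -> (4 %| wt (wstar u v))%N.
Proof.
move=> C8 uC vC.
have := dvdn_add (C8 _ uC) (C8 _ vC).
by rewrite -wtD dvdn_addr ?C8 ?memvD // (@dvdn_pmul2l 2 4).
Qed.

Lemma triply_even_inner C u v w :
    triply_even C -> u \in C -> v \in C -> w \in C ->
  inner u (wstar v w) = 0.
Proof.
by move=> C8 uC vC wC; rewrite inner_wstar_eq0 ?(dvdn4_wt_wstar C8) ?memvD.
Qed.

(** With [D] equal to [C] this is one half of the duality statement; with [D]
    larger it yields maximality. *)
Lemma triply_even_sub_dual C D :
  triply_even D -> (C <= D)%VS -> (D <= dual (cstar C C))%VS.
Proof.
move=> D8 /subvP sCD; apply/subvP => u uD; apply/mem_dual_cstar => v w vC wC.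
by apply: triply_even_inner D8 _ _ _ => //; apply: sCD.
Qed.

(** The sum factors over the coordinates: each position in [supp y] contributes
    [1 + i], every other position contributes 1. *)
Lemma sum_exprI_wt y :
  \sum_(x | wstar x y == x) 'i ^+ wt x = (1 + 'i) ^+ wt y :> algC.
Proof.
(* The expansion of a product of sums is indexed by subsets, so words are
   exchanged for their supports. *)
pose ind (A : {set 'I_n}) : 'rV['F_2]_n := \row_i (i \in A)%:R.
have indK : cancel ind (@supp n).
  by move=> A; apply/setP => i; rewrite inE mxE; case: (i \in A).
have suppK : cancel (@supp n) ind.
  move=> x; apply/rowP => i; rewrite mxE inE.
  by case: (F2P (x 0 i)) => ->.
rewrite (reindex ind) /=; last by exists (@supp n) => ? _.
have -> : (1 + 'i) ^+ wt y
    = \prod_i ((if i \in supp y then 'i else 0) + 1) :> algC.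
  rewrite /wt -prodr_const [LHS]big_mkcond; apply: eq_bigr => i _.
  by case: ifP; rewrite ?add0r // addrC.
rewrite bigA_distr big_mkcond /=; apply: eq_bigr => A _.
rewrite -(inj_eq (can_inj suppK)) supp_wstar indK -big_mkcond /=.
rewrite /wt indK; case: eqP => [/setIidPl/subsetP sAy | nsAy].
  by rewrite -prodr_const; apply: eq_bigr => i /sAy ->.
have /subsetPn[i iA /negbTE iy]: ~~ (A \subset supp y).
  by apply/negP => /setIidPl.
by rewrite (bigD1 i) //= iy mul0r.
Qed.

(** From [wt (x + c) = wt x + wt c - 2 wt (x * c)], since [i ^ 2 = -1]. *)
Lemma exprI_wtD x c : (4 %| wt c)%N ->
  'i ^+ wt (x + c) = 'i ^+ wt x * (-1) ^+ wt (wstar x c) :> algC.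
Proof.
case/dvdnP=> k wc.
have <- : 'i ^+ (wt (x + c) + 2 * wt (wstar x c)) * (-1) ^+ wt (wstar x c)
   = 'i ^+ wt (x + c) :> algC.
  by rewrite exprD exprM sqrCi -mulrA -exprMn mulrNN mulr1 expr1n mulr1.
rewrite wtD wc exprD mulnC exprM.
have -> : 'i ^+ 4 = 1 :> algC by rewrite (exprM _ 2 2) sqrCi sqrrN expr1n.
by rewrite expr1n mulr1.
Qed.

(** Orthogonality of characters: the translation by [c0] changes the sign of
    every term. *)
Lemma sum_sign_inner (D : pred 'rV['F_2]_n) x c0 :
    (forall c, D (c + c0) = D c) -> inner x c0 != 0 ->
  \sum_(c | D c) (-1) ^+ wt (wstar x c) = 0 :> algC.
Proof.
move=> Dc0 xc0; set S := LHS.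
have SN : S = - S.
  rewrite {1}/S (reindex (+%R^~ c0)) /=; last first.
    by exists (+%R^~ c0) => c _; rewrite -addrA word_addvv addr0.
  rewrite -sumrN; apply: eq_big => [c | c _]; first exact: Dc0.
  rewrite -signr_odd -[in RHS]signr_odd.
  have /(congr1 odd) := wtD (wstar x c) (wstar x c0).
  rewrite !(wstarC x) -wstarDl mul2n !oddD odd_double addbF => ->.
  move: xc0; rewrite inner_eq0 dvdn2 negbK wstarC => ->.
  by rewrite addbT signrN.
have: S *+ 2 = 0 by rewrite mulr2n {1}SN addNr.
by move/eqP; rewrite mulrn_eq0 => /eqP.
Qed.

End Words.

Section Concatenation.
Variables m n : nat.
Implicit Types (a c : 'rV['F_2]_m) (b d : 'rV['F_2]_n).

Lemma wt_row_mx a b : wt (row_mx a b) = (wt a + wt b)%N.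
Proof.
rewrite !wtE big_split_ord /=.
by congr addn; apply: eq_bigr => i _; rewrite ?row_mxEl ?row_mxEr.
Qed.

Lemma wstar_row_mx a b c d :
  wstar (row_mx a b) (row_mx c d) = row_mx (wstar a c) (wstar b d).
Proof.
apply/rowP => i; rewrite mxE -[i]splitK.
by case: (split i) => j /=; rewrite ?row_mxEl ?row_mxEr mxE.
Qed.

Lemma inner_row_mx a b c d :
  inner (row_mx a b) (row_mx c d) = inner a c + inner b d.
Proof. by rewrite !inner_wt wstar_row_mx wt_row_mx natrD. Qed.

End Concatenation.

(** * Multipliers of a doubly even self-dual code *)

Section SelfDual.
Variables (n : nat) (C : {vspace 'rV['F_2]_n}).
Hypotheses (C4 : doubly_even C) (Csd : self_dual C).
Implicit Types x y r : 'rV['F_2]_n.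

Lemma self_dualP x : reflect (forall v, v \in C -> inner x v = 0) (x \in C).
Proof. by rewrite {2}Csd; apply: mem_dual. Qed.

Lemma mem_ones : const_mx 1 \in C.
Proof.
apply/self_dualP => v vC; apply/eqP.
by rewrite inner_eq0 wstarC wstar1 (dvdn_trans _ (C4 vC)).
Qed.

Lemma multiplierP r :
  reflect (forall x, x \in C -> wstar r x \in C) (r \in dual (cstar C C)).
Proof.
apply: (iffP (mem_dual_cstar _ _ _)) => [h x xC | h x y xC yC].
  by apply/self_dualP => y yC; rewrite innerA h.
by rewrite -innerA; move: y yC; apply/self_dualP/h.
Qed.

Lemma multiplier_mem r : r \in dual (cstar C C) -> r \in C.
Proof. by move/multiplierP/(_ _ mem_ones); rewrite wstar1. Qed.

(** Words below [y] that are orthogonal to the part [D] of [C] below [y] are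
    orthogonal to all of [C], because [x * y = x] lets [y] be moved onto the
    codeword, and [y * c] lies in [D]; hence they belong to [D].  Averaging the
    sum over its translates by [D] therefore kills every term outside [D], by
    cancellation of signs, and turns the others into 1 since [C] is doubly
    even. *)
Lemma sum_exprI_multiplier y : y \in dual (cstar C C) ->
  \sum_(x | wstar x y == x) 'i ^+ wt x
    = #|[pred c | (c \in C) && (wstar c y == c)]|%:R :> algC.
Proof.
move=> /multiplierP yC.
pose U x := wstar x y == x; pose D c := (c \in C) && U c.
have UD c0 x : U c0 -> U (x + c0) = U x.
  by move/eqP=> Uc0; rewrite /U wstarDl Uc0 (can_eq (addrK _)).
have orthU x : U x -> (forall c, D c -> inner x c = 0) -> x \in C.
  move=> /eqP Ux xD; apply/self_dualP => c cC.
  by rewrite -Ux innerA xD // /D yC //= /U wstarC wstarA wstarvv.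
have D0 : #|D|%:R != 0 :> algC.
  rewrite pnatr_eq0 -lt0n; apply/card_gt0P; exists 0.
  by rewrite unfold_in /D mem0v /U wstar0 eqxx.
apply: (mulfI D0); rewrite mulr_natl -sumr_const.
transitivity (\sum_(c | D c) \sum_(x | U x) 'i ^+ wt (x + c) : algC).
  apply: eq_bigr => c /andP[_ Uc].
  rewrite [LHS](reindex (+%R^~ c)) /=; last first.
    by exists (+%R^~ c) => x _; rewrite -addrA word_addvv addr0.
  by apply: eq_bigl => x; rewrite -/(U _) UD.
rewrite exchange_big /= (bigID (mem C)) /= [X in _ + X]big1 => [|x].
  rewrite addr0 mulr_natl -sumr_const.
  apply: eq_big => [x | x /andP[Ux xC]]; first by rewrite andbC.
  rewrite -sumr_const; apply: eq_bigr => c /andP[cC _].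
  have /dvdnP[k ->] : (4 %| wt (x + c))%N by apply: C4; rewrite memvD.
  by rewrite mulnC exprM (exprM _ 2 2) sqrCi sqrrN !expr1n.
case/andP=> Ux xNC.
under eq_bigr => c /andP[cC _] do rewrite exprI_wtD ?C4 //.
rewrite -mulr_sumr.
have [/forall_inP h | ] := boolP [forall (c | D c), inner x c == 0].
  by rewrite orthU // in xNC => c /h/eqP.
case/forall_inPn => c /andP[cC Uc] xc.
rewrite (@sum_sign_inner _ _ _ c) ?mulr0 // => c'.
by rewrite /D UD // rpredDr.
Qed.

(** A form of the theorem that a doubly even self-dual code has length
    divisible by 8: a multiplier [y] splits off the part of [C] below [y],
    which is such a code on [supp y].  Comparing the two values of the sum
    gives [(1 + i) ^ wt y >= 0]; as [4 | wt y] and [(1 + i) ^ 4 = -4], the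
    quotient [wt y / 4] is even. *)
Lemma multiplier_wt8 y : y \in dual (cstar C C) -> (8 %| wt y)%N.
Proof.
move=> yCC; have /dvdnP[m wy] := C4 (multiplier_mem yCC).
have : (0 : algC) <= (- 4%:R) ^+ m.
  have <- : \sum_(x | wstar x y == x) 'i ^+ wt x = (- 4%:R) ^+ m :> algC.
    rewrite sum_exprI_wt wy mulnC exprM; congr (_ ^+ m).
    rewrite (exprM _ 2 2) sqrrD sqrCi expr1n mul1r.
    rewrite addrAC subrr add0r -mulr_natl exprMn sqrCi -natrX.
    by rewrite mulrN1.
  by rewrite sum_exprI_multiplier // ler0n.
rewrite wy (@dvdn_pmul2r 4 2) // dvdn2 exprNn -signr_odd.
by case: (odd m) => //; rewrite expr1 mulN1r oppr_ge0 -natrX lern0 expn_eq0.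
Qed.

(** For [r] in [C], the vanishing of [Bform x r] for all [x] in [C] says that
    every [wt (x * r)] is divisible by 4.  By [inner_wstar_eq0] this makes [r]
    orthogonal to [C * C].  Conversely, for a multiplier [r] the words [r * x]
    are codewords, and [8 | wt r] by [multiplier_wt8].  In particular [Rad C]
    is a subspace, although [Bform] need not be bilinear. *)
Lemma mem_Rad r : (r \in Rad C) = (r \in dual (cstar C C)).
Proof.
apply/idP/idP => [|rCC]; last first.
  have rC := multiplier_mem rCC.
  rewrite !inE multiplier_wt8 // -Csd rC !andbT /=.
  apply/forall_inP => x xC; rewrite /Bform natF2_eq0 wstarC.
  have /C4/dvdnP[k ->] := multiplierP _ rCC x xC.
  by rewrite (mulnA k 2 2) [X in X./2]muln2 doubleK dvdn_mull.
rewrite !inE -Csd -andbA => /and3P[rC /forall_inP Br _].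
have r4 x : x \in C -> (4 %| wt (wstar x r))%N.
  move=> xC; have := Br x xC; rewrite /Bform natF2_eq0.
  have : (2 %| wt (wstar x r))%N.
    by rewrite -inner_eq0; move/self_dualP: xC => ->.
  by case/dvdnP => k ->; rewrite muln2 doubleK -muln2 (@dvdn_pmul2r 2 2).
apply/mem_dual_cstar => x x' xC x'C.
by rewrite inner_wstar_eq0 ?r4 ?memvD.
Qed.

(** * The generalized doubling *)

Lemma gdoublingP u : u \in gdoubling C ->
  exists r x, [/\ r \in dual (cstar C C), x \in C & u = row_mx (r + x) x].
Proof.
pose P u := exists r x,
  [/\ r \in dual (cstar C C), x \in C & u = row_mx (r + x) x].
move: u; apply: (F2_span_ind (P := P)) => [|u v|u].
- by exists 0, 0; rewrite !mem0v addr0 row_mx0.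
- move=> [r [x [rC xC {u}->]]] [r' [x' [r'C x'C {v}->]]].
  exists (r + r'), (x + x'); rewrite !memvD // add_row_mx; split=> //.
  by rewrite addrACA.
rewrite mem_cat => /orP[] /mapP[x]; rewrite mem_enum.
  by rewrite inE mem_Rad => /andP[_ xR ->]; exists x, 0; rewrite addr0 mem0v.
by move=> xC ->; exists 0, x; rewrite add0r mem0v.
Qed.

Lemma gdoubling_row0 r :
  r \in dual (cstar C C) -> row_mx r 0 \in gdoubling C.
Proof.
move=> rR; apply: memv_span; rewrite mem_cat; apply/orP; left.
by apply: map_f; rewrite mem_enum inE mem_Rad rR multiplier_mem.
Qed.

Lemma gdoubling_diag x : x \in C -> row_mx x x \in gdoubling C.
Proof.
move=> xC; apply: memv_span; rewrite mem_cat; apply/orP; right.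
by apply: (map_f (fun x => row_mx x x)); rewrite mem_enum.
Qed.

Lemma gdoubling_triply_even : triply_even (gdoubling C).
Proof.
move=> _ /gdoublingP[r [x [rR xC ->]]]; rewrite wt_row_mx.
have x4 := C4 xC; have /C4 rx4 := multiplierP _ rR x xC.
have E := wtD r x.
(* Adding [2 wt (r * x)] avoids the subtraction. *)
rewrite -(dvdn_addl _ (_ : 8 %| 2 * wt (wstar r x))%N); last first.
  by rewrite (@dvdn_pmul2l 2 4).
rewrite addnAC E -addnA addnn -mul2n dvdn_add ?multiplier_wt8 //.
by rewrite (@dvdn_pmul2l 2 4).
Qed.

Lemma dual_cstar_gdoubling_sub :
  (dual (cstar (gdoubling C) (gdoubling C)) <= gdoubling C)%VS.
Proof.
apply/subvP => u /mem_dual_cstar.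
rewrite -[u]hsubmxK; set a := lsubmx u; set b := rsubmx u => h.
have abR : a + b \in dual (cstar C C).
  apply/mem_dual_cstar => x y xC yC.
  have := h _ _ (gdoubling_diag xC) (gdoubling_diag yC).
  by rewrite wstar_row_mx inner_row_mx -innerDl.
have oneR : const_mx 1 \in dual (cstar C C).
  by apply/multiplierP => x xC; rewrite wstarC wstar1.
have aC : a \in C.
  apply/self_dualP => x xC.
  have := h _ _ (gdoubling_row0 oneR) (gdoubling_diag xC).
  by rewrite wstar_row_mx inner_row_mx wstarC wstar1 wstar0 inner0r addr0.
have bC : b \in C by rewrite -(addKr a b) rpredD ?rpredN // multiplier_mem.
have -> : row_mx a b = row_mx (a + b) 0 + row_mx b b.
  by rewrite add_row_mx add0r -addrA word_addvv addr0.
by rewrite memvD ?gdoubling_row0 ?gdoubling_diag.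
Qed.

End SelfDual.

Theorem proposition10 (n : nat) (C : {vspace 'rV['F_2]_n}) :
  doubly_even C -> self_dual C ->
  dual (cstar (gdoubling C) (gdoubling C)) = gdoubling C /\
  maximal_triply_even (gdoubling C).
Proof.
move=> C4 Csd; have D8 := gdoubling_triply_even C4 Csd.
have dualD : dual (cstar (gdoubling C) (gdoubling C)) = gdoubling C.
  apply/eqP; rewrite eqEsubv dual_cstar_gdoubling_sub //.
  by rewrite triply_even_sub_dual.
split=> //; split=> // E E8 sDE; apply/eqP; rewrite eqEsubv sDE andbT.
by rewrite -[X in (_ <= X)%VS]dualD triply_even_sub_dual.
Qed.
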